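(* Let $G\colon\mathbb{R}^n\to\mathbb{R}^+$ be a twice continuously differentiable, convex and positive-valued function. Then $G$ is the equidistant function belonging to some positive-valued, twice continuously differentiable convex function $f\colon\mathbb{R}^n\to\mathbb{R}^+$ if and only if all of the following hold: the mapping $H\colon\mathbb{R}^n\to\mathbb{R}^n$, $$H(x):=x-\frac{2G(x)}{1+|\nabla G(x)|^2}\,\nabla G(x),$$ is a one-to-one correspondence (bijection of $\mathbb{R}^n$ onto $\mathbb{R}^n$) with nowhere vanishing Jacobian; $|\nabla G(x)|<1$ for any $x\in\mathbb{R}^n$; and the mapping $$Y=\frac{2\nabla G}{1-|\nabla G|^2}$$ satisfies the monotonicity property $$\langle Y(x_1)-Y(x_2),\,H(x_1)-H(x_2)\rangle\ge 0\qquad\text{for all }x_1,x_2\in\mathbb{R}^n.$$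
   Context: $\mathbb{R}^{n+1}$ carries the Euclidean distance $d$, and $d(p,S)=\inf\{d(p,q)\mid q\in S\}$ for a point $p$ and a set $S$. For a positive-valued continuous function $f\colon\mathbb{R}^n\to\mathbb{R}^+$ let $K=\mathbb{R}^n\times\{0\}\subset\mathbb{R}^{n+1}$ and $L=\{(t,f(t))\mid t\in\mathbb{R}^n\}\subset\mathbb{R}^{n+1}$. For each $x\in\mathbb{R}^n$ there is a unique positive real number $G(x)$ with $d((x,G(x)),L)=d((x,G(x)),K)$; the resulting function $G\colon\mathbb{R}^n\to\mathbb{R}^+$, whose graph is the equidistant set $\{p\in\mathbb{R}^{n+1}\mid d(p,K)=d(p,L)\}$, is called the equidistant function belonging to $f$. $\nabla$ denotes the gradient and $\langle\cdot,\cdot\rangle$ the canonical inner product of $\mathbb{R}^n$. *)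

(* Defs.v *)
From mathcomp Require Import all_boot all_order all_algebra.
From mathcomp Require Import all_classical all_reals all_analysis.

Set Implicit Arguments.
Unset Strict Implicit.
Unset Printing Implicit Defensive.

Import Order.TTheory GRing.Theory Num.Theory.
Import numFieldNormedType.Exports.

Local Open Scope classical_set_scope.
Local Open Scope ring_scope.

(* The norm that the library puts on 'rV[R]_n is the sup norm. It induces the
   same topology and the same derivatives as the Euclidean norm, but lengths
   and distances have to be the Euclidean ones defined here. *)
Definition dot (R : realType) (n : nat) (u v : 'rV[R]_n) : R :=
  \sum_(i < n) u 0 i * v 0 i.

Definition enorm (R : realType) (n : nat) (u : 'rV[R]_n) : R :=
  Num.sqrt (dot u u).

Definition dist_to (R : realType) (n : nat) (p : 'rV[R]_n)
    (S : set 'rV[R]_n) : R :=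
  inf [set enorm (p - q) | q in S].

Definition partial (R : realType) (n : nat) (i : 'I_n) (g : 'rV[R]_n -> R) :
    'rV[R]_n -> R :=
  fun x => 'D_(delta_mx 0 i) g x.

Definition grad (R : realType) (n : nat) (g : 'rV[R]_n -> R) (x : 'rV[R]_n) :
    'rV[R]_n :=
  \row_(i < n) partial i g x.

Definition C1 (R : realType) (n : nat) (g : 'rV[R]_n -> R) : Prop :=
  (forall x, differentiable g x) /\ (forall i, continuous (partial i g)).

Definition C2 (R : realType) (n : nat) (g : 'rV[R]_n -> R) : Prop :=
  C1 g /\ (forall i, C1 (partial i g)).

Definition positive_valued (R : realType) (n : nat) (g : 'rV[R]_n -> R) :
    Prop :=
  forall x, 0 < g x.

(* (x, y) in R^n x R, as a row of R^(n+1). *)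
Definition graph_pt (R : realType) (n : nat) (x : 'rV[R]_n) (y : R) :
    'rV[R]_(n + 1) :=
  row_mx x y%:M.

Definition base_plane (R : realType) (n : nat) : set 'rV[R]_(n + 1) :=
  [set graph_pt t 0 | t in [set: 'rV[R]_n]].
Arguments base_plane : clear implicits.

Definition graph_of (R : realType) (n : nat) (f : 'rV[R]_n -> R) :
    set 'rV[R]_(n + 1) :=
  [set graph_pt t (f t) | t in [set: 'rV[R]_n]].

Definition equidistant_function (R : realType) (n : nat)
    (f G : 'rV[R]_n -> R) : Prop :=
  forall x, unique (fun y : R => 0 < y /\
    dist_to (graph_pt x y) (graph_of f) = dist_to (graph_pt x y) (base_plane R n))
    (G x).

Definition mapH (R : realType) (n : nat) (G : 'rV[R]_n -> R) (x : 'rV[R]_n) :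
    'rV[R]_n :=
  x - (2 * G x / (1 + enorm (grad G x) ^+ 2)) *: grad G x.

Definition mapY (R : realType) (n : nat) (G : 'rV[R]_n -> R) (x : 'rV[R]_n) :
    'rV[R]_n :=
  (2 / (1 - enorm (grad G x) ^+ 2)) *: grad G x.

(* Main.v *)
Require Import Defs.
From mathcomp Require Import all_boot all_order all_algebra.
From mathcomp Require Import all_classical all_reals all_analysis.
From mathcomp Require Import ring lra.
Import Order.TTheory GRing.Theory Num.Theory.
Import numFieldNormedType.Exports.
Local Open Scope classical_set_scope.
Local Open Scope ring_scope.
Set Implicit Arguments.
Unset Strict Implicit.
Unset Printing Implicit Defensive.

(* The ball of radius G x around (x, G x) is tangent to the base plane, so
   equidistance says that it touches the graph of f at some (t, f t). Comparing
   G with the touching balls (envelope) gives x - t = f t grad G x, hence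
   t = H x and f (H x) = 2 G x / (1 + |grad G x|^2); normality at t gives
   (1 - |grad G x|^2) grad f (H x) = 2 grad G x, so |grad G| <> 1, and
   |grad G| > 1 is impossible by the intermediate value theorem. Hence
   grad f o H = Y, and monotonicity of Y along H is convexity of f. Since Y
   determines grad G, which together with H x determines x, H is injective; it
   is surjective because for convex f the ball on the normal at t which is
   tangent to the base plane does touch the graph at t.

   Conversely f is defined by the formula above through the inverse of H, which
   is C1 by the inverse function theorem; differentiating the sphere equation
   |x - H x|^2 + f (H x)^2 = 2 G x f (H x) yields grad f o H = Y. *)

(** * Algebra of the Euclidean inner product *)

Section Dot.
Context {R : realType} {n : nat}.
Implicit Types (u v w : 'rV[R]_n) (a : R).

Lemma dotC u v : dot u v = dot v u.
Proof. by apply: eq_bigr => i _; rewrite mulrC. Qed.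

Lemma dotDl u v w : dot (u + v) w = dot u w + dot v w.
Proof. by rewrite -big_split; apply: eq_bigr => i _; rewrite mxE mulrDl. Qed.

Lemma dotZl a u v : dot (a *: u) v = a * dot u v.
Proof. by rewrite mulr_sumr; apply: eq_bigr => i _; rewrite mxE mulrA. Qed.

Lemma dotNl u v : dot (- u) v = - dot u v.
Proof. by rewrite -scaleN1r dotZl mulN1r. Qed.

Lemma dotDr u v w : dot u (v + w) = dot u v + dot u w.
Proof. by rewrite dotC dotDl !(dotC u). Qed.

Lemma dotZr a u v : dot u (a *: v) = a * dot u v.
Proof. by rewrite dotC dotZl dotC. Qed.

Lemma dotNr u v : dot u (- v) = - dot u v.
Proof. by rewrite dotC dotNl dotC. Qed.

Lemma dot0l v : dot 0 v = 0.
Proof. by rewrite -(scale0r 0) dotZl mul0r. Qed.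

Definition dotE := (dotDl, dotDr, dotNl, dotNr, dotZl, dotZr).

Lemma dot_ge0 u : 0 <= dot u u.
Proof. by apply: sumr_ge0 => i _; rewrite -expr2 sqr_ge0. Qed.

Lemma dot_eq0 u : dot u u = 0 -> u = 0.
Proof.
move=> /eqP; rewrite psumr_eq0 => [/allP u0|i _]; last by rewrite -expr2 sqr_ge0.
apply/rowP => i; rewrite mxE; apply/eqP.
by have := u0 i (mem_index_enum i); rewrite -expr2 sqrf_eq0.
Qed.

Lemma dot_delta u i : dot u (delta_mx 0 i) = u 0 i.
Proof.
rewrite /dot (bigD1 i) //= big1 => [|j ji]; rewrite mxE ?eqxx ?mulr1 ?addr0 //=.
by rewrite (negbTE ji) mulr0.
Qed.

Lemma dot_inj u v : (forall w, dot u w = dot v w) -> u = v.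
Proof. by move=> uv; apply/rowP => i; rewrite -!dot_delta. Qed.

Lemma enorm_sqr u : enorm u ^+ 2 = dot u u.
Proof. by rewrite sqr_sqrtr ?dot_ge0. Qed.

(** The largest squared coordinate is one term of the sum of squares. Through this bound, compact
    sup-norm balls serve for minimizing Euclidean distances. *)
Lemma normr_sqr_le_dot u : `|u| ^+ 2 <= dot u u.
Proof.
have [->|] := eqVneq `|u| 0; first by rewrite expr0n dot_ge0.
move=> /mx_norm_neq0 [[i j] /= uE].
rewrite [`|u|]uE (ord1 i) real_normK ?num_real //.
rewrite /dot (bigD1 j) //= expr2 lerDl sumr_ge0 // => k _.
by rewrite -expr2 sqr_ge0.
Qed.

Lemma dot_graph_pt (u v : 'rV[R]_n) (a b : R) :
  dot (graph_pt u a) (graph_pt v b) = dot u v + a * b.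
Proof.
rewrite /dot big_split_ord big_ord1; congr (_ + _).
  by apply: eq_bigr => i _; rewrite !row_mxEl.
by rewrite !row_mxEr !mxE !eqxx !mulr1n.
Qed.

Lemma graph_ptB (u v : 'rV[R]_n) (a b : R) :
  graph_pt u a - graph_pt v b = graph_pt (u - v) (a - b).
Proof. by rewrite /graph_pt opp_row_mx add_row_mx raddfB. Qed.

End Dot.

(** * Continuity and derivatives of row-valued maps, restriction to lines, critical points *)

Section Calculus.
Context {R : realType}.

Lemma differentiable_rowP {V : normedModType R} {m} (f : V -> 'rV[R]_m) x :
  differentiable f x <-> forall j, differentiable (fun y => f y 0 j) x.
Proof.
split=> [df j|df].
  exact: (differentiable_comp df (differentiable_coord _ _ _)).
have -> : f = fun y => \sum_(j < m) f y 0 j *: delta_mx 0 j :> 'rV[R]_m.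
  by apply/funext => y; rewrite -row_sum_delta.
rewrite (_ : (fun _ => _) = \sum_(j < m) (fun y => f y 0 j *: delta_mx 0 j)).
  by apply: differentiable_sum => j; exact: differentiableZl.
by apply/funext => y; rewrite fct_sumE.
Qed.

Lemma continuous_rowP {T : topologicalType} {m} (f : T -> 'rV[R]_m) x :
  {for x, continuous f} <-> forall j, {for x, continuous (fun y => f y 0 j)}.
Proof.
split=> [cf j|cf].
  exact: (continuous_comp cf (@coord_continuous _ _ _ _ _ _)).
have -> : f = fun y => \sum_(j < m) f y 0 j *: delta_mx 0 j :> 'rV[R]_m.
  by apply/funext => y; rewrite -row_sum_delta.
apply: (cvg_big (@add_continuous _)) => j _.
by apply: cvgZr_tmp; exact: cf.
Qed.

Lemma continuous_dist {V W : normedModType R} (h : V -> W) x :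
  (forall e : R, 0 < e -> \forall y \near x, `|h x - h y| < e) ->
  {for x, continuous h}.
Proof. by move=> hx; apply/cvgrPdist_lt. Qed.

Lemma continuous_distl {V : normedModType R} (a : V) :
  continuous (fun x => `|a - x|).
Proof.
by move=> x; apply: cvg_norm; apply: cvgB; [exact: cvg_cst | exact: cvg_id].
Qed.

Lemma compact_norm_ball {m} (a : 'rV[R]_m) (r : R) :
  compact [set x | `|a - x| <= r].
Proof.
apply: bounded_closed_compact.
  exists (`|a| + r); split; first exact: num_real.
  move=> M aM x /= xr; apply: (le_trans _ (ltW aM)).
  by rewrite -[x](subKr a) (le_trans (ler_normB _ _)) // lerD2l.
by apply: preimage_closed (@closed_le _ r) => x _; exact: continuous_distl.
Qed.

(** Continuity sends increments of [g] at [y] to 0, so an estimate valid for all small [k] may be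
    used with [k] such an increment. *)
Lemma near_increment {V W : normedModType R} (g : V -> W) y (P : set W) :
  {for y, continuous g} -> (\forall k \near 0, P k) ->
  \forall h \near 0, P (g (h + y) - g y).
Proof.
move=> cg hP.
have cy : (h + y) @[h --> (0 : V)] --> y.
  by rewrite -{2}(add0r y); apply: cvgD; [exact: cvg_id | exact: cvg_cst].
have cgy : g (h + y) @[h --> (0 : V)] --> g y by apply: cvg_comp cy cg.
have : (g (h + y) - g y) @[h --> (0 : V)] --> g y - g y.
  by apply: cvgB cgy _; exact: cvg_cst.
by rewrite subrr; apply.
Qed.

Lemma near_lt {T : topologicalType} (h : T -> R) x c :
  {for x, continuous h} -> h x < c -> \forall y \near x, h y < c.
Proof. by move=> ch hc; exact: (cvgr_lt _ ch). Qed.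

Context {V : normedModType R} {n : nat}.
Implicit Types a b : V -> 'rV[R]_n.

Lemma is_derive_dot a b da db x v : is_derive x v a da -> is_derive x v b db ->
  is_derive x v (fun y => dot (a y) (b y)) (dot da (b x) + dot (a x) db).
Proof.
move=> [a1 a2] [b1 b2].
have ai j : is_derive x v (fun y => a y 0 j) (da 0 j).
  by split; [move/derivable_mxP: a1; apply | rewrite -a2 derive_mx // mxE].
have bi j : is_derive x v (fun y => b y 0 j) (db 0 j).
  by split; [move/derivable_mxP: b1; apply | rewrite -b2 derive_mx // mxE].
rewrite (_ : (fun _ => _) =
    \sum_(j < n) (fun y => a y 0 j) * (fun y => b y 0 j)); last first.
  by apply/funext => y; rewrite fct_sumE.
apply: is_derive_eq.
rewrite -big_split; apply: eq_bigr => j _ /=.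
by rewrite /GRing.scale /= addrC; congr (_ + _); rewrite mulrC.
Qed.

Lemma differentiable_dot a b x : differentiable a x -> differentiable b x ->
  differentiable (fun y => dot (a y) (b y)) x.
Proof.
move=> /differentiable_rowP da /differentiable_rowP db.
rewrite (_ : (fun _ => _) =
    \sum_(j < n) (fun y => a y 0 j) * (fun y => b y 0 j)); last first.
  by apply/funext => y; rewrite fct_sumE.
by apply: differentiable_sum => j; exact: differentiableM.
Qed.

Lemma continuous_dot {T : topologicalType} (a b : T -> 'rV[R]_n) x :
  {for x, continuous a} -> {for x, continuous b} ->
  {for x, continuous (fun y => dot (a y) (b y))}.
Proof.
move=> /continuous_rowP ca /continuous_rowP cb.
apply: (cvg_big (@add_continuous _)) => j _.
by apply: cvgM; [exact: ca | exact: cb].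
Qed.

Lemma is_derive_line (h : V -> R) x v (s : R) :
  differentiable h (s *: v + x) ->
  is_derive s 1 (fun r => h (r *: v + x)) ('D_v h (s *: v + x)).
Proof.
move=> dh; have dline : differentiable (fun r : R => r *: v + x) s by [].
split; first exact/derivable1_diffP/(differentiable_comp dline).
rewrite /derive; set g1 := fun r => _; set g2 := fun r => _.
suff -> : g1 = g2 by [].
by rewrite /g1 /g2; apply/funext => r /=; rewrite [r%:A]mulr1 scalerDl addrA.
Qed.

Lemma continuous_line (h : V -> R) x v : continuous h ->
  continuous (fun r : R => h (r *: v + x)).
Proof.
move=> ch r; apply: (@continuous_comp _ _ _ (fun r : R => r *: v + x) h).
  exact: differentiable_continuous.
exact: ch.
Qed.

(** Restricted to the line through [x] in direction [v], [h] has an interior minimum at parameter 0,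
    which is Fermat's rule in one variable. *)
Lemma derive_local_min (h : V -> R) x v : (forall y, differentiable h y) ->
  (\forall y \near x, h x <= h y) -> 'D_v h x = 0.
Proof.
move=> dh hx; pose line (s : R) := s *: v + x.
have line0 : line 0 = x by rewrite /line scale0r add0r.
have cl : line s @[s --> 0] --> line 0 by exact: differentiable_continuous.
have : \forall s \near 0, h x <= h (line s).
  by apply: (cl [set y | h x <= h y]); rewrite line0.
move=> /nbhs_ballP[e /= e0 he].
have dline t := is_derive_line (dh (t *: v + x)).
have : is_derive (0 : R) 1 (h \o line) 0.
  apply: (@derive1_at_min _ _ (- e) e).
  - by rewrite ge0_cp // ltW.
  - by move=> t _; case: (dline t).
  - by rewrite in_itv /= oppr_lt0 e0.
  - move=> t; rewrite in_itv /= line0 => te; apply: he.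
    by rewrite /ball /= sub0r normrN ltr_norml.
by case=> _ <-; case: (dline 0) => _ ->; rewrite -/(line 0) line0.
Qed.

Lemma derive_min (h : V -> R) x v : (forall y, differentiable h y) ->
  (forall y, h x <= h y) -> 'D_v h x = 0.
Proof. by move=> dh hx; apply: derive_local_min => //; exact: nearW. Qed.

End Calculus.

(** * Directional derivatives through gradients and Jacobian matrices *)

Section Gradient.
Context {R : realType} {n : nat}.
Implicit Types (h : 'rV[R]_n -> R) (x v : 'rV[R]_n).

Lemma derive_grad h x v : differentiable h x -> 'D_v h x = dot (grad h x) v.
Proof.
move=> dh; rewrite [in LHS](row_sum_delta v) deriveE // linear_sum.
apply: eq_bigr => j _; rewrite linearZ /= -deriveE // mxE mulrC.
by [].
Qed.

Lemma is_derive_grad h x v : differentiable h x ->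
  is_derive x v h (dot (grad h x) v).
Proof. by move=> dh; split; [exact: diff_derivable | exact: derive_grad]. Qed.

Lemma is_derive_diff {m} (h : 'rV[R]_n -> 'rV[R]_m) x v : differentiable h x ->
  is_derive x v h ('D_v h x).
Proof. by move=> dh; split=> //; exact: diff_derivable. Qed.

End Gradient.

Lemma derive_coord {R : realType} {V : normedModType R} {m}
  (h : V -> 'rV[R]_m) x v j : differentiable h x ->
  ('D_v h x) 0 j = 'D_v (fun y => h y 0 j) x.
Proof. by move=> dh; rewrite derive_mx ?mxE //; exact: diff_derivable. Qed.

Lemma jacobianE {R : realType} {n m} (h : 'rV[R]_n -> 'rV[R]_m) x i j :
  differentiable h x -> jacobian h x i j = partial i (fun y => h y 0 j) x.
Proof.
move=> dh; rewrite /partial -derive_coord // deriveEjacobian //.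
by rewrite -rowE [in RHS]mxE.
Qed.

(** * Closure properties of continuously differentiable functions *)

Section C1Functions.
Context {R : realType} {n : nat}.
Implicit Types f g : 'rV[R]_n -> R.

Lemma C1_cst (c : R) : C1 (fun _ : 'rV[R]_n => c).
Proof.
split=> [x|i x]; first exact: differentiable_cst.
rewrite (_ : partial i _ = cst 0); first exact: cst_continuous.
by apply/funext => y; exact: derive_cst.
Qed.

Lemma C1_coord j : C1 (fun x : 'rV[R]_n => x 0 j).
Proof.
split=> [x|i x]; first exact: differentiable_coord.
rewrite (_ : partial i _ = cst ((delta_mx 0 i : 'rV[R]_n) 0 j)).
  exact: cst_continuous.
apply/funext => y; rewrite /partial -(@derive_coord _ _ _ id) //.
by rewrite derive_id.
Qed.

Lemma C1D f g : C1 f -> C1 g -> C1 (fun x => f x + g x).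
Proof.
move=> [df cf] [dg cg]; split=> [x|i]; first exact: differentiableD.
rewrite (_ : partial i _ = partial i f + partial i g).
  by move=> x; apply: continuousD; [exact: (cf i x) | exact: (cg i x)].
by apply/funext => x; apply: deriveD; exact: diff_derivable.
Qed.

Lemma C1M f g : C1 f -> C1 g -> C1 (fun x => f x * g x).
Proof.
move=> [df cf] [dg cg]; split=> [x|i]; first exact: differentiableM.
rewrite (_ : partial i _ =
    f * partial i g + g * partial i f).
  move=> x; apply: continuousD; apply: continuousM.
  - exact: differentiable_continuous.
  - exact: (cg i x).
  - exact: differentiable_continuous.
  - exact: (cf i x).
by apply/funext => x; apply: deriveM; exact: diff_derivable.
Qed.

Lemma C1V f : C1 f -> (forall x, f x != 0) -> C1 (fun x => (f x)^-1).
Proof.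
move=> [df cf] f0; split=> [x|i]; first exact: differentiableV.
rewrite (_ : partial i _ =
    - ((fun x => (f x)^-1) * (fun x => (f x)^-1)) * partial i f).
  have cfV : continuous (fun x => (f x)^-1).
    by move=> x; apply: differentiable_continuous; exact: differentiableV.
  move=> x; apply: continuousM; last exact: (cf i x).
  by apply: continuousN; apply: continuousM; exact: cfV.
apply/funext => x; rewrite /partial deriveV //; last exact: diff_derivable.
by rewrite expr2 invfM.
Qed.

Lemma C1_sum (I : Type) (r : seq I) (F : I -> 'rV[R]_n -> R) :
  (forall i, C1 (F i)) -> C1 (fun x => \sum_(i <- r) F i x).
Proof.
move=> CF; elim: r => [|i r IH].
  rewrite (_ : (fun _ => _) = fun=> 0); first exact: C1_cst.
  by apply/funext => x; rewrite big_nil.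
rewrite (_ : (fun _ => _) = fun x => F i x + \sum_(j <- r) F j x).
  exact: C1D.
by apply/funext => x; rewrite big_cons.
Qed.

Lemma C1_continuous f : C1 f -> continuous f.
Proof. by move=> [df _] x; exact: differentiable_continuous. Qed.

Lemma C1_comp {m} (f : 'rV[R]_m -> R) (h : 'rV[R]_n -> 'rV[R]_m) :
  C1 f -> (forall j, C1 (fun x => h x 0 j)) -> C1 (fun x => f (h x)).
Proof.
move=> [df cf] Ch.
have dh x : differentiable h x by apply/differentiable_rowP => j; case: (Ch j).
split=> [x|i]; first exact: (differentiable_comp (dh x)).
rewrite (_ : partial i _ = fun x => dot (grad f (h x)) ('D_(delta_mx 0 i) h x)).
  move=> x; apply: (@continuous_dot _ _ 'rV[R]_n (grad f \o h)
    ('D_(delta_mx 0 i) h)); apply/continuous_rowP => j.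
    rewrite (_ : (fun _ => _) = partial j f \o h).
      apply: continuous_comp; last exact: (cf j (h x)).
      exact: differentiable_continuous.
    by apply/funext => y /=; rewrite mxE.
  rewrite (_ : (fun _ => _) = partial i (fun y => h y 0 j)).
    by case: (Ch j) => _; apply.
  by apply/funext => y; rewrite derive_coord.
apply/funext => x; rewrite /partial deriveE; last first.
  exact: (differentiable_comp (dh x)).
by rewrite diff_comp //= -!deriveE // derive_grad.
Qed.

End C1Functions.

(** * Continuity of determinants and inverse matrices *)

Lemma continuous_det {R : realType} {T : topologicalType} {m}
  (M : T -> 'M[R]_m) : (forall i j, continuous (fun y => M y i j)) ->
  continuous (fun y => \det (M y)).
Proof.
move=> cM y; apply: (cvg_big (@add_continuous _)) => s _.
apply: cvgM; first exact: cvg_cst.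
by apply: (cvg_big (@mul_continuous _)) => i _; exact: cM.
Qed.

(** By Cramer's rule the entries are cofactors divided by the determinant. *)
Lemma continuous_invmx {R : realType} {T : topologicalType} {m}
  (M : T -> 'M[R]_m) : (forall i j, continuous (fun y => M y i j)) ->
  (forall y, M y \in unitmx) ->
  forall i j, continuous (fun y => invmx (M y) i j).
Proof.
move=> cM Mu i j.
rewrite (_ : (fun _ => _) = fun y => (\det (M y))^-1 * cofactor (M y) j i).
  move=> y; apply: cvgM.
    apply: cvgV; last exact: continuous_det.
    by have := Mu y; rewrite unitmxE unitfE.
  apply: cvgM; first exact: cvg_cst.
  apply: (@continuous_det _ _ _ (fun y => row' j (col' i (M y)))) => k l.
  rewrite (_ : (fun _ => _) = fun y => M y (lift j k) (lift i l)).
    exact: cM.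
  by apply/funext => z; rewrite !mxE.
by apply/funext => y; rewrite /invmx Mu !mxE.
Qed.

(** * The inverse function theorem for a map with a global inverse *)

Section InverseFunction.
Context {R : realType} {n : nat}.
Variables H g : 'rV[R]_n -> 'rV[R]_n.
Hypotheses (HK : cancel H g) (gK : cancel g H).
Hypothesis dH : forall x, differentiable H x.
Hypothesis detH : forall x, \det (jacobian H x) != 0.

Lemma jacobian_unitmx x : jacobian H x \in unitmx.
Proof. by rewrite unitmxE unitfE. Qed.

(* Given y near H x0, the minimum of |H x - y|^2 over a ball around x0 is
   interior, because injectivity keeps H x0 away from the image of the sphere;
   there the gradient vanishes, so H x = y as the Jacobian is invertible. *)
Lemma inverse_continuous : continuous g.
Proof.
move=> y0; apply: continuous_dist => r r0; set x0 := g y0.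
pose q (y x : 'rV[R]_n) := dot (H x - y) (H x - y).
have dq y x : differentiable (q y) x.
  by apply: differentiable_dot; exact: differentiableB.
have cq y : continuous (q y).
  by move=> x; exact: differentiable_continuous.
have q0 y x : q y x = 0 -> H x = y.
  by move=> /dot_eq0 /eqP; rewrite subr_eq0 => /eqP.
pose S := [set x : 'rV[R]_n | `|x0 - x| = r].
pose B := [set x : 'rV[R]_n | `|x0 - x| <= r].
have cdist : continuous (fun x : 'rV[R]_n => `|x0 - x|).
  exact: continuous_distl.
have cB : compact B by exact: compact_norm_ball.
have cS : compact S.
  apply: (subclosed_compact _ cB); last by move=> x xS; rewrite /B /= xS.
  by apply: preimage_closed (@closed_eq _ r) => x _; exact: cdist.
have [d d0 hd] : exists2 d, 0 < d & forall x, S x -> d <= q y0 x.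
  have [->|/set0P S0] := eqVneq S set0; first by exists 1.
  have [c cS' minc] := EVT_min_rV S0 cS (continuous_subspaceT (cq y0)).
  exists (q y0 c); last by move=> x Sx; apply: minc; rewrite inE.
  rewrite lt_neqAle dot_ge0 andbT eq_sym; apply/eqP => /q0 Hc.
  move: cS'; rewrite inE /S /= /x0 -Hc HK subrr normr0 => r0'.
  by rewrite -r0' ltxx in r0.
(* The factor 4 comes from |u - w|^2 <= 2 |u|^2 + 2 |w|^2 <= 4 |w|^2 < d below, which contradicts
   [hd] if the minimizer [c] lies on the sphere. *)
have near_y : \forall y \near y0, dot (y0 - y) (y0 - y) < d / 4.
  apply: near_lt; last by rewrite subrr dot0l divr_gt0.
  apply: differentiable_continuous.
  by apply: differentiable_dot; apply: differentiableB.
apply: filterS near_y => y yd.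
have B0 : B !=set0 by exists x0; rewrite /B /= subrr normr0 ltW.
have [c cB' minc] := EVT_min_rV B0 cB (continuous_subspaceT (cq y)).
have qc : q y c <= dot (y0 - y) (y0 - y).
  rewrite (_ : dot _ _ = q y x0); last by rewrite /q /x0 gK.
  by apply: minc; rewrite inE /B /= subrr normr0 ltW.
have cr : `|x0 - c| < r.
  move: cB'; rewrite inE /B /= le_eqVlt => /orP[/eqP/hd dqc|//].
  have := dot_ge0 ((H c - y) + (y0 - y)).
  rewrite /q in qc; set u := H c - y in qc *; set w := y0 - y in qc yd *.
  have dE : q y0 c = dot (u - w) (u - w).
    by rewrite /q /u /w opprB addrA subrK.
  move: dqc; rewrite dE; clearbody u w; rewrite !dotE (dotC w u); lra.
suff -> : g y = c by [].
rewrite -(@q0 y c) //.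
have minq : \forall x \near c, q y c <= q y x.
  have : \forall x \near c, `|x0 - x| < r by exact: near_lt (cdist c) cr.
  by apply: filterS => x xr; apply: minc; rewrite inE /B /= ltW.
set u := H c - y.
(* In this direction the derivative of [H] at [c] is [u] itself, so that of [q y] is 2 |u|^2. *)
have := derive_local_min (u *m invmx (jacobian H c)) (dq y) minq.
have dHc v : is_derive c v (fun x => H x - y) ('D_v H c).
  rewrite -['D_v H c]subr0.
  exact: (is_deriveB (is_derive_diff v (dH c)) (is_derive_cst y c v)).
move: (is_derive_dot (dHc (u *m invmx (jacobian H c)))
  (dHc (u *m invmx (jacobian H c)))) => [_ ->].
rewrite deriveEjacobian // mulmxKV ?jacobian_unitmx // /q -/u => E; lra.
Qed.

Lemma mulmxr_continuous {m} (A : 'M[R]_(n, m)) :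
  continuous (mulmxr A : 'rV[R]_n -> 'rV[R]_m).
Proof.
move=> x; apply/continuous_rowP => j.
rewrite (_ : (fun _ => _) = fun v => dot v (col j A)^T).
  by apply: differentiable_continuous; apply: differentiable_dot.
apply/funext => v; rewrite /= !mxE; apply: eq_bigr => i _.
by rewrite !mxE.
Qed.

(** With [k] the increment of [g] for [h], the expansion of [H] at [x] gives h = k J + o(k).
    Multiplying by the inverse [A] of J leaves h A - k = o(k), and [k] is at most a constant times
    [h]. *)
Lemma inverse_diff y : differentiable g y /\
  'd g y = mulmxr (invmx (jacobian H (g y))) :> (_ -> _).
Proof.
set x := g y; set A := invmx _.
have cA := @mulmxr_continuous n A.
have expand : g \o shift y = cst (g y) + mulmxr A +o_ 0 id.
  apply/eqaddoP => _/posnumP[e].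
  have [M M0 hM] := linear_lipschitz cA.
  (* The first bound gives M eta <= 1/2, which absorbs [k] and yields |k| <= 2 M |h|; the second
     then makes the error at most e |h|. *)
  pose eta := Num.min (M^-1 / 2) (e%:num / (2 * M * M)).
  have eta0 : 0 < eta by rewrite lt_min !divr_gt0 ?invr_gt0 ?mulr_gt0.
  have := dH x; rewrite diff_locallyP => -[_ /eqaddoP /(_ _ eta0) hH].
  have cg : {for y, continuous g} by exact: inverse_continuous.
  move: (near_increment cg hH); apply: filterS => h /=.
  set k := g (h + y) - x.
  rewrite /= /cst !fctE /= /k subrK gK /x gK -/x -/k => hk.
  have Ek : h *m A - k = (h - k *m jacobian H x) *m A.
    by rewrite mulmxBl mulmxK ?jacobian_unitmx.
  have b1 : `|h *m A - k| <= M * (eta * `|k|).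
    rewrite Ek; apply: (le_trans (hM _)); apply: ler_wpM2l; first exact: ltW.
    by move: hk; rewrite /jacobian mul_rV_lin1 opprD addrA addrK.
  have b2 : `|h *m A| <= M * `|h| by exact: hM.
  have e1 : M * eta <= 1 / 2.
    by rewrite mulrC -ler_pdivlMr // mulrC mul1r ge_min mulrC lexx.
  have e2 : 2 * M * M * eta <= e%:num.
    by rewrite mulrC -ler_pdivlMr ?mulr_gt0 // ge_min lexx orbT.
  have b3 : `|k| <= `|h *m A| + `|h *m A - k|.
    by rewrite -{1}(subKr (h *m A) k) ler_normB.
  have k0 : 0 <= `|k| by [].
  have h0 : 0 <= `|h| by [].
  have b4 : `|k| <= 2 * (M * `|h|) by nra.
  rewrite opprD addrA -/k -normrN opprB.
  have : M * (eta * `|k|) <= M * eta * (2 * (M * `|h|)).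
    by rewrite mulrA ler_wpM2l // mulr_ge0 // ltW.
  nra.
have dgE := diff_unique cA expand.
by split=> //; apply/diff_locallyP; rewrite dgE.
Qed.

Lemma inverse_C1 : (forall j, C1 (fun x => H x 0 j)) ->
  forall j, C1 (fun y => g y 0 j).
Proof.
move=> CH j; have dg y : differentiable g y by case: (inverse_diff y).
split=> [y|i]; first by move: j; apply/differentiable_rowP.
rewrite (_ : partial i _ = fun y => invmx (jacobian H (g y)) i j); last first.
  apply/funext => y; rewrite -jacobianE // mxE; have [_ ->] := inverse_diff y.
  by rewrite /= -rowE mxE.
apply: continuous_invmx => [k l|y]; last exact: jacobian_unitmx.
rewrite (_ : (fun _ => _) = partial k (fun x => H x 0 l) \o g).
  move=> y; apply: continuous_comp; first exact: inverse_continuous.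
  by case: (CH l) => _ /(_ k); apply.
by apply/funext => y; rewrite jacobianE.
Qed.

End InverseFunction.

(** * Convexity, supporting hyperplanes and monotone gradients *)

Section Convexity.
Context {R : realType} {n : nat}.
Variable f : 'rV[R]_n -> R.
Hypothesis df : forall x, differentiable f x.

Definition supported (a b : 'rV[R]_n) := f a + dot (grad f a) (b - a) <= f b.

(** For 0 < h <= 1 convexity bounds the difference quotient along [b - a] by [f b - f a]; the bound
    passes to the limit from the right. *)
Lemma convex_supported a b :
  convex_function [set: 'rV[R]_n] f -> supported a b.
Proof.
move=> cf; rewrite /supported -lerBrDl -derive_grad //.
have dfv : derivable f a (b - a) by exact: diff_derivable.
rewrite /derive cvg_at_rightE //; apply: limr_le.
  rewrite -cvg_at_rightE //.
  apply: cvg_trans dfv; apply: cvg_app => A [e e0 Ae].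
  by exists e => // x xe x0; apply: Ae => //; exact: lt0r_neq0.
near=> h.
have h0 : 0 < h by [].
have h1 : h <= 1 by near: h; apply: nbhs_right_le.
have := cf (Itv01 (ltW h0) h1) b a; rewrite !inE => /(_ I I).
rewrite convRE => hconv.
rewrite /= -[leLHS]/(h^-1 * _) ler_pdivrMl //.
have -> : h *: (b - a) + a = h *: b + (1 - h) *: a.
  by rewrite scalerBr scalerBl scale1r -addrA (addrC a).
have {}hconv : f (h *: b + (1 - h) *: a) <= h * f b + (1 - h) * f a.
  exact: hconv.
lra.
Unshelve. all: by end_near. Qed.

(** In the weighted sum of the supporting inequalities at the convex combination [c], tested at [a]
    and [b], the gradient terms cancel. *)
Lemma supported_convex : (forall a b, supported a b) ->
  convex_function [set: 'rV[R]_n] f.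
Proof.
move=> sf t a b _ _; rewrite convRE.
set c := conv t _ _.
have cE : c = t%:num *: a + (1 - t%:num) *: b by [].
have := sf c a; have := sf c b; rewrite /supported.
have -> : a - c = (1 - t%:num) *: (a - b).
  by apply/rowP => i; rewrite cE !mxE; ring.
have -> : b - c = (- t%:num) *: (a - b).
  by apply/rowP => i; rewrite cE !mxE; ring.
rewrite !dotZr; set D := dot _ _; rewrite /unstable.onem => hb ha.
have t0 : 0 <= t%:num by [].
have t1 : 0 <= 1 - t%:num by rewrite subr_ge0.
nra.
Qed.

(** By the mean value theorem [f b - f a] is the slope at an intermediate point of the segment, and
    monotonicity makes it at least the slope at [a]. *)
Lemma monotone_supported :
  (forall a b, 0 <= dot (grad f a - grad f b) (a - b)) ->
  forall a b, supported a b.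
Proof.
move=> mf a b; set v := b - a.
have dline s := is_derive_line (df (s *: v + a)).
have cline : continuous (fun s : R => f (s *: v + a)).
  by apply: continuous_line => x; exact: differentiable_continuous.
have [s] := MVT ltr01 (fun s _ => dline s) (continuous_subspaceT cline).
rewrite in_itv /= scale1r scale0r add0r subr0 mulr1 /v subrK => /andP[s0 s1] E.
have := mf (s *: v + a) a; rewrite addrK dotZr pmulr_rge0 // dotDl dotNl.
rewrite -derive_grad // -E /supported -/v; lra.
Qed.

End Convexity.

(** * Equidistance as contact of a ball with the graph *)

Section Equidistant.
Context {R : realType} {n : nat}.

Lemma inf_min (A : set R) m : A m -> lbound A m -> inf A = m.
Proof.
move=> Am lbA; apply/eqP; rewrite eq_le ge_inf ?lb_le_inf //.
  by exists m.
by exists m.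
Qed.

Lemma dist_base_plane (x : 'rV[R]_n) y : 0 <= y ->
  dist_to (graph_pt x y) (base_plane R n) = y.
Proof.
move=> y0; apply: inf_min.
  exists (graph_pt x 0); first by exists x.
  by rewrite /enorm graph_ptB dot_graph_pt subrr dot0l add0r subr0 -expr2
    sqrtr_sqr ger0_norm.
move=> _ [_ [t _ <-] <-].
rewrite /enorm graph_ptB dot_graph_pt subr0 -{1}(ger0_norm y0) -sqrtr_sqr.
by rewrite ler_sqrt ?addr_ge0 ?dot_ge0 // ?mulr_ge0 // expr2 lerDr dot_ge0.
Qed.

Variable f : 'rV[R]_n -> R.

(* The ball of radius y around (x, y), which is tangent to the base plane,
   touches the graph of f at (t, f t): y^2 <= |x - s|^2 + (y - f s)^2 with
   equality at t, after cancelling y^2. *)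
Definition touches x y t :=
  (forall s, 2 * y * f s <= dot (x - s) (x - s) + f s ^+ 2) /\
  2 * y * f t = dot (x - t) (x - t) + f t ^+ 2.

Let sqdist (x : 'rV[R]_n) (y : R) (t : 'rV[R]_n) :=
  dot (x - t) (x - t) + (y - f t) ^+ 2.

Let graph_dist x y t :
  enorm (graph_pt x y - graph_pt t (f t)) = Num.sqrt (sqdist x y t).
Proof. by rewrite /enorm graph_ptB dot_graph_pt -expr2. Qed.

Let sqdist_ge0 x y t : 0 <= sqdist x y t.
Proof. by rewrite addr_ge0 ?dot_ge0 ?sqr_ge0. Qed.

Lemma sqdist_min x y : continuous f ->
  exists t, forall s, sqdist x y t <= sqdist x y s.
Proof.
(* The graph is not compact, but since [1 <= r] gives [r <= r ^+ 2], beyond sup-norm distance [r]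
   from [x] the horizontal part alone exceeds [sqdist x y x]. *)
move=> cf; pose r := sqdist x y x + 1.
have r1 : 1 <= r by rewrite lerDr.
pose B := [set t : 'rV[R]_n | `|x - t| <= r].
have cB : compact B by exact: compact_norm_ball.
have Bx : B x by rewrite /B /= subrr normr0 (le_trans ler01).
have cq : continuous (sqdist x y).
  move=> t; rewrite (_ : sqdist x y = (fun t => dot (x - t) (x - t)) +
    (fun t => (y - f t) ^+ 2)) //; apply: continuousD.
    by apply: differentiable_continuous; apply: differentiable_dot.
  apply: (@continuous_comp _ _ _ f (fun z => (y - z) ^+ 2)); first exact: cf.
  by apply: differentiable_continuous.
have B0 : B !=set0 by exists x.
have [t tB mint] := EVT_min_rV B0 cB (continuous_subspaceT cq).
exists t => s; have [sB|] := boolP (s \in B); first exact: mint.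
rewrite notin_setE /B /= => /negP; rewrite -ltNge => rs.
have /le_trans -> // : sqdist x y t <= sqdist x y x by apply: mint; rewrite inE.
have : r <= `|x - s| ^+ 2 by nra.
have := normr_sqr_le_dot (x - s); have := sqr_ge0 (y - f s).
rewrite /sqdist -/r; rewrite -[dot _ _ + (y - f x) ^+ 2]/(sqdist x y x) /r; lra.
Qed.

(** The distance to the graph is attained, and the distance to the plane is [y]; squaring their
    equality and cancelling [y ^+ 2] gives [touches] at a nearest point. *)
Lemma equidistantP x y : continuous f -> 0 < y ->
  dist_to (graph_pt x y) (graph_of f) = dist_to (graph_pt x y) (base_plane R n)
  <-> exists t, touches x y t.
Proof.
move=> cf y0; rewrite dist_base_plane ?ltW //.
have sqE t : sqdist x y t =
    y ^+ 2 + (dot (x - t) (x - t) + f t ^+ 2 - 2 * y * f t).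
  by rewrite /sqdist; ring.
have dist_min t : (forall s, sqdist x y t <= sqdist x y s) ->
    dist_to (graph_pt x y) (graph_of f) = Num.sqrt (sqdist x y t).
  move=> mint; apply: inf_min.
    by rewrite -graph_dist; exists (graph_pt t (f t)) => //; exists t.
  by move=> _ [_ [s _ <-] <-]; rewrite graph_dist ler_sqrt.
split=> [|[t [le_s eq_t]]].
  have [t mint] := sqdist_min x y cf.
  rewrite (dist_min t) // => /(congr1 (fun z => z ^+ 2)).
  rewrite sqr_sqrtr // => Ey; exists t; split.
    by move=> s; have := mint s; rewrite Ey sqE; lra.
  by move: Ey; rewrite sqE; lra.
rewrite (dist_min t); last by move=> s; rewrite !sqE; have := le_s s; lra.
by rewrite sqE eq_t subrr addr0 sqrtr_sqr ger0_norm // ltW.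
Qed.

(** Testing each ball at the contact point of the other gives [y <= y'] and [y' <= y] after division
    by a positive value of [f]. *)
Lemma touches_unique x y y' t t' : positive_valued f ->
  touches x y t -> touches x y' t' -> y = y'.
Proof.
move=> fp [le1 eq1] [le2 eq2].
have := le1 t'; rewrite -eq2; have := le2 t; rewrite -eq1.
have := fp t; have := fp t'; nra.
Qed.

Lemma equidistant_functionP (G : 'rV[R]_n -> R) :
  continuous f -> positive_valued f -> positive_valued G ->
  equidistant_function f G <-> forall x, exists t, touches x (G x) t.
Proof.
move=> cf fp Gp; split=> [eqG x|tG x].
  by have [[_ dE] _] := eqG x; apply/equidistantP.
split; first by split=> //; apply/equidistantP.
have [t txt] := tG x => y [y0 /equidistantP dE].
by have [s /(touches_unique fp txt)] := dE cf y0.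
Qed.

End Equidistant.

(** * First-order conditions at a contact point *)

Section Touching.
Context {R : realType} {n : nat}.
Variable f : 'rV[R]_n -> R.
Hypothesis df : forall x, differentiable f x.

(* (x, y) lies on the downward normal to the graph of f at t, and the supporting
   hyperplane there separates the graph from the ball. *)
Lemma supported_touches x y t : (forall s, supported f t s) -> y <= f t ->
  x - t = (f t - y) *: grad f t ->
  2 * y * f t = dot (x - t) (x - t) + f t ^+ 2 -> touches f x y t.
Proof.
move=> sup yft xt eq_t; split=> // s.
have -> : x - s = (x - t) + (t - s) by rewrite addrA subrK.
have := sup s; rewrite /supported -opprB dotNr => sup_s.
have := dot_ge0 (t - s).
move: eq_t; set u := x - t in xt *; set w := t - s in sup_s * => eq_t.
have uw : dot u w = (f t - y) * dot (grad f t) w by rewrite xt dotZl.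
clearbody u w; rewrite !dotE (dotC w u) uw.
set d := dot (grad f t) w in sup_s *.
have : 0 <= (f t - y) * (f s - (f t - d)) by rewrite mulr_ge0 ?subr_ge0 //; lra.
have := sqr_ge0 (f s - f t).
nra.
Qed.

(** With the ball fixed, the contact point minimizes [k] over the graph; this is the vanishing of
    its gradient. *)
Lemma touches_stationary x y t : touches f x y t ->
  x - t = (f t - y) *: grad f t.
Proof.
move=> [le_s eq_t]; apply: dot_inj => v.
pose k s := dot (x - s) (x - s) + f s * f s - 2 * y * f s.
have dk s : differentiable k s.
  apply: differentiableB; last exact: differentiableM.
  apply: differentiableD; last exact: differentiableM.
  by apply: differentiable_dot; exact: differentiableB.
have kmin : forall s, k t <= k s.
  by move=> s; have := le_s s; rewrite /k eq_t; lra.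
have := derive_min v dk kmin.
have dxs : is_derive t v (fun s => x - s) (0 - v) by exact: is_deriveB.
have dft := is_derive_grad v (df t).
have dkt : is_derive t v k _ := is_deriveB (is_deriveD (is_derive_dot dxs dxs)
  (is_deriveM dft dft)) (is_deriveM (is_derive_cst (2 * y) t v) dft).
case: dkt => _ ->; rewrite /GRing.scale /= sub0r dotNl dotNr dotZl (dotC v).
lra.
Qed.

Variable G : 'rV[R]_n -> R.
Hypothesis dG : forall x, differentiable G x.

(** Here the contact point [t] is fixed and the centre varies: no ball of the family contains
    [(t, f t)] in its interior, so [k] is minimal at [x]. *)
Lemma touches_envelope x t :
  (forall x, exists t, touches f x (G x) t) -> positive_valued f ->
  touches f x (G x) t -> x - t = f t *: grad G x.
Proof.
move=> tG fp [_ eq_t]; apply: dot_inj => v.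
pose k z := dot (z - t) (z - t) - 2 * f t * G z.
have dk z : differentiable k z.
  apply: differentiableB; last exact: differentiableM.
  by apply: differentiable_dot; exact: differentiableB.
have kmin : forall z, k x <= k z.
  by move=> z; have [s [/(_ t)]] := tG z; rewrite /k; lra.
have := derive_min v dk kmin.
have dxs : is_derive x v (fun z => z - t) (v - 0) by exact: is_deriveB.
have dkt : is_derive x v k _ := is_deriveB (is_derive_dot dxs dxs)
  (is_deriveM (is_derive_cst (2 * f t) x v) (is_derive_grad v (dG x))).
case: dkt => _ ->; rewrite /GRing.scale /= subr0 dotZl (dotC v).
lra.
Qed.

End Touching.

(** * The maps built from [G] and their regularity *)

Section EquidistantMaps.
Context {R : realType} {n : nat}.
Variable G : 'rV[R]_n -> R.
Hypothesis G_pos : positive_valued G.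

(* The value at mapH G x of the function to which G belongs. *)
Definition mapF x := 2 * G x / (1 + dot (grad G x) (grad G x)).

Lemma den_gt0 x : 0 < 1 + dot (grad G x) (grad G x).
Proof. by rewrite ltr_pwDl // dot_ge0. Qed.

Lemma mapF_gt0 x : 0 < mapF x.
Proof. by rewrite divr_gt0 ?den_gt0 // mulr_gt0. Qed.

Lemma mapFE x : mapF x * (1 + dot (grad G x) (grad G x)) = 2 * G x.
Proof. by rewrite divfK // gt_eqF // den_gt0. Qed.

Lemma mapHE x : mapH G x = x - mapF x *: grad G x.
Proof. by rewrite /mapH enorm_sqr. Qed.

Lemma mapYE x : mapY G x = (2 / (1 - dot (grad G x) (grad G x))) *: grad G x.
Proof. by rewrite /mapY enorm_sqr. Qed.

Lemma sub_mapH x : x - mapH G x = mapF x *: grad G x.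
Proof. by rewrite mapHE subKr. Qed.

Lemma sub_mapH_coord (x : 'rV[R]_n) j :
  x 0 j - mapH G x 0 j = mapF x * partial j G x.
Proof. by rewrite mapHE !mxE subKr. Qed.

(** This places [(mapH G x, mapF x)] on the sphere of radius [G x] around [(x, G x)]. *)
Lemma mapF_sphere x :
  2 * G x * mapF x = dot (x - mapH G x) (x - mapH G x) + mapF x ^+ 2.
Proof. by rewrite sub_mapH dotZl dotZr -mapFE; ring. Qed.

Lemma enorm_lt1 x : (enorm (grad G x) < 1) = (dot (grad G x) (grad G x) < 1).
Proof.
have e0 : 0 <= enorm (grad G x) by exact: sqrtr_ge0.
by rewrite -enorm_sqr -[X in _ = (_ < X)](expr1n _ 2) ltr_pXn2r ?nnegrE.
Qed.

Hypothesis G_C2 : C2 G.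

Lemma C1_grad_sqr : C1 (fun x => dot (grad G x) (grad G x)).
Proof.
have -> : (fun x => dot (grad G x) (grad G x)) =
    fun x => \sum_(i < n) partial i G x * partial i G x.
  by apply/funext => x; apply: eq_bigr => i _; rewrite !mxE.
by apply: C1_sum => i; case: G_C2 => _ /(_ i) Ci; exact: C1M.
Qed.

Lemma C1_mapF : C1 mapF.
Proof.
apply: C1M; first by apply: C1M; [exact: C1_cst | case: G_C2].
apply: C1V; first by apply: C1D; [exact: C1_cst | exact: C1_grad_sqr].
by move=> x; rewrite gt_eqF // den_gt0.
Qed.

Lemma C1_mapH j : C1 (fun x => mapH G x 0 j).
Proof.
have -> : (fun x => mapH G x 0 j) =
    fun x => x 0 j + -1 * (mapF x * partial j G x).
  by apply/funext => x; rewrite mapHE !mxE mulN1r.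
apply: C1D; first exact: C1_coord.
apply: C1M; first exact: C1_cst.
by apply: C1M; [exact: C1_mapF | case: G_C2].
Qed.

Lemma differentiable_mapH x : differentiable (mapH G) x.
Proof. by apply/differentiable_rowP => j; case: (C1_mapH j). Qed.

Lemma C1_mapY : (forall x, dot (grad G x) (grad G x) < 1) ->
  forall j, C1 (fun x => mapY G x 0 j).
Proof.
move=> p1 j; have -> : (fun x => mapY G x 0 j) =
    fun x => 2 * (1 + -1 * dot (grad G x) (grad G x))^-1 * partial j G x.
  by apply/funext => x; rewrite mapYE !mxE mulN1r.
apply: C1M; last by case: G_C2.
apply: C1M; first exact: C1_cst.
apply: C1V.
  apply: C1D; first exact: C1_cst.
  by apply: C1M; [exact: C1_cst | exact: C1_grad_sqr].
by move=> x; rewrite mulN1r gt_eqF // subr_gt0.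
Qed.

End EquidistantMaps.

(** * Necessity: properties of [G] when it belongs to a convex [f] *)

Section Necessity.
Context {R : realType} {n : nat}.
Variables f G : 'rV[R]_n -> R.
Hypotheses (f_pos : positive_valued f) (f_C2 : C2 f).
Hypothesis f_convex : convex_function [set: 'rV[R]_n] f.
Hypotheses (G_pos : positive_valued G) (G_C2 : C2 G).
Hypothesis touchG : forall x, exists t, touches f x (G x) t.

Let df x : differentiable f x. Proof. by case: f_C2 => [[]]. Qed.
Let dG x : differentiable G x. Proof. by case: G_C2 => [[]]. Qed.
Let sup a b : supported f a b. Proof. exact: convex_supported. Qed.
Notation p := (grad G).
Notation F := (mapF G).
Notation H := (mapH G).

(** Inserting the envelope relation into the contact equation leaves a common factor [f t], which is
    positive and cancels. *)
Lemma touches_mapF x t : touches f x (G x) t -> f t = F x.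
Proof.
move=> txt; have xt := touches_envelope dG touchG f_pos txt.
case: txt => _; rewrite xt dotZl dotZr => eq_t.
have ft := f_pos t; have d0 := den_gt0 G x.
have := mapFE G x; rewrite mulrC => /(canRL (mulKf (lt0r_neq0 d0))) ->.
apply: (mulfI (lt0r_neq0 d0)); rewrite mulVKf ?gt_eqF //.
apply: (mulIf (lt0r_neq0 ft)); rewrite eq_t; ring.
Qed.

Lemma touches_mapH x t : touches f x (G x) t -> t = H x.
Proof.
move=> txt; have xt := touches_envelope dG touchG f_pos txt.
by rewrite mapHE -(touches_mapF txt) -xt subKr.
Qed.

Lemma mapH_touches x : touches f x (G x) (H x).
Proof. by have [t txt] := touchG x; rewrite -(touches_mapH txt). Qed.

Lemma f_mapH x : f (H x) = F x.
Proof. exact/touches_mapF/mapH_touches. Qed.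

(** Stationarity and envelope give two expressions for [x - H x]; equate them, use 2 (F - G) = F (1
    - |p|^2) and cancel F. Nothing is divided by 1 - |p|^2, whose sign is still open. *)
Lemma grad_mapH x : (1 - dot (p x) (p x)) *: grad f (H x) = 2 *: p x.
Proof.
have := touches_stationary df (mapH_touches x); rewrite sub_mapH f_mapH => E.
have F0 := mapF_gt0 G_pos x; apply: (scalerI (lt0r_neq0 F0)).
rewrite !scalerA [in RHS]mulrC -[in RHS]scalerA E scalerA; congr (_ *: _).
by have := mapFE G x; lra.
Qed.

(** If |p| >= 1, then F <= G, while the ball condition at [x] gives 2 G <= f x. So [f] takes the
    value G between [H x] and [x], and the ball condition there yields G^2 <= G^2 - (G - F)^2. Hence
    F = G and |p| = 1, whereas [grad_mapH] then gives p = 0. *)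
Lemma grad_lt1 x : dot (p x) (p x) < 1.
Proof.
rewrite ltNge; apply/negP => p1.
have F0 := mapF_gt0 G_pos x; have FE := mapFE G x; have Gx := G_pos x.
have FG : F x <= G x by nra.
have [/(_ x) + eqH] := mapH_touches x.
rewrite subrr dot0l add0r expr2 ler_pM2r ?f_pos // => Gfx.
have cf : continuous f by move=> y; exact: differentiable_continuous.
have cline : continuous (fun r : R => f (r *: (x - H x) + H x)).
  exact: continuous_line.
have := @IVT _ _ 0 1 (G x) ler01 (continuous_subspaceT cline).
rewrite scale0r scale1r add0r subrK f_mapH.
case; first by rewrite ge_min FG /= le_max; apply/orP; right; lra.
move=> r; rewrite in_itv /= => /andP[r0 r1] Gr.
have [/(_ (r *: (x - H x) + H x)) + _] := mapH_touches x.
rewrite Gr; have -> : x - (r *: (x - H x) + H x) = (1 - r) *: (x - H x).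
  by rewrite scalerBl scale1r opprD addrCA addrC.
rewrite dotZl dotZr sub_mapH dotZl dotZr.
set pp := dot (p x) (p x) in FE p1 * => le_r.
have FpG : F x * (F x * pp) = G x ^+ 2 - (G x - F x) ^+ 2 by nra.
have rr : (1 - r) * (1 - r) <= 1 by nra.
have FGE : F x = G x.
  have X0 : 0 <= F x * (F x * pp).
    by apply: mulr_ge0; [|apply: mulr_ge0; [|exact: dot_ge0]]; exact: ltW.
  have rX := ler_piMl X0 rr; rewrite -mulrA in rX.
  have h1 := sqr_ge0 (G x - F x).
  have : (G x - F x) ^+ 2 <= 0 by move: le_r rX; rewrite FpG; lra.
  by rewrite le_eqVlt ltNge h1 orbF sqrf_eq0 subr_eq0 => /eqP.
have pp1 : pp = 1 by rewrite FGE in FE; nra.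
have := grad_mapH x; rewrite -/pp pp1 subrr scale0r => /eqP.
rewrite eq_sym scaler_eq0 pnatr_eq0 /= => /eqP p0.
by move: pp1; rewrite /pp p0 dot0l => /eqP; rewrite eq_sym oner_eq0.
Qed.

Lemma mapY_mapH x : mapY G x = grad f (H x).
Proof.
have p1 : 1 - dot (p x) (p x) != 0 by rewrite gt_eqF // subr_gt0 grad_lt1.
by apply: (scalerI p1); rewrite grad_mapH mapYE scalerA mulrC divfK.
Qed.

(** Both gradients are positive multiples a Y of the same Y with 2 a = 1 - a^2 |Y|^2, an equation
    with only one positive root. *)
Lemma grad_inj x1 x2 : grad f (H x1) = grad f (H x2) -> p x1 = p x2.
Proof.
move=> E; have := grad_mapH x1; have := grad_mapH x2; rewrite -E.
have := grad_lt1 x1; have := grad_lt1 x2; set Y := grad f _.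
set u := p x1; set w := p x2 => w1 u1 wY uY.
have multiple v : dot v v < 1 -> (1 - dot v v) *: Y = 2 *: v ->
    exists a, [/\ 0 < a, 2 * a = 1 - a * a * dot Y Y & v = a *: Y].
  move=> v1 vY; have vE : v = ((1 - dot v v) / 2) *: Y.
    by rewrite mulrC -scalerA vY scalerA mulVf ?scale1r.
  have := congr1 (fun w => dot w w) vE; rewrite dotZl dotZr mulrA => ddE.
  move: ddE vE; set a := _ / 2 => ddE vE; exists a; split; last exact: vE.
    by rewrite /a divr_gt0 ?subr_gt0.
  by rewrite -ddE /a mulrC divfK.
have [b [b0 bE wE]] := multiple _ w1 wY.
have [a [a0 aE uE]] := multiple _ u1 uY.
suff ab : a = b by rewrite uE wE ab.
have Y0 := dot_ge0 Y.
apply/eqP; rewrite -subr_eq0.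
have : (a - b) * (2 + (a + b) * dot Y Y) = 0 by nra.
have abY := mulr_ge0 (addr_ge0 (ltW a0) (ltW b0)) Y0.
move/eqP; rewrite mulf_eq0 => /orP[//|/eqP]; lra.
Qed.

Lemma mapH_inj : injective H.
Proof.
move=> x1 x2 E; have pE : p x1 = p x2 by apply: grad_inj; rewrite E.
by rewrite -[x1](subrK (H x1)) -[x2](subrK (H x2)) !sub_mapH -!f_mapH E pE.
Qed.

(* The point touching the graph at t lies on the normal there, at the height
   where the ball also touches the base plane. *)
Lemma mapH_surj t : exists x, H x = t.
Proof.
set Y := grad f t; set s := Num.sqrt (1 + dot Y Y).
have Y0 := dot_ge0 Y; have ft := f_pos t.
have ss : s * s = 1 + dot Y Y by rewrite -expr2 sqr_sqrtr // addr_ge0.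
have s0 : 0 <= s by exact: sqrtr_ge0.
have s1 : 0 < 1 + s by rewrite ltr_pwDl.
(* The centre [(t + c *: Y, f t - c)] has distance c s from [(t, f t)]; this equals its height
   exactly when c (1 + s) = f t. *)
set c := f t / (1 + s); have c0 : 0 < c by rewrite divr_gt0.
have cs : c * (1 + s) = f t by rewrite divfK // gt_eqF.
have xt : t + c *: Y - t = c *: Y by rewrite addrC addKr.
have txt : touches f (t + c *: Y) (f t - c) t.
  apply: supported_touches => //; first by rewrite gerBl ltW.
    by rewrite xt subKr.
  rewrite xt dotZl dotZr.
  have -> : dot Y Y = s * s - 1 by rewrite ss; lra.
  rewrite -cs; ring.
exists (t + c *: Y); apply/esym/touches_mapH.
by rewrite -(touches_unique f_pos txt (mapH_touches (t + c *: Y))).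
Qed.

Lemma mapH_bij : bijective H.
Proof.
have [g gK] := choice mapH_surj.
by exists g => // x; apply: mapH_inj; rewrite gK.
Qed.

(** As [mapY G] is the gradient of [f] at [H], this is the sum of the two supporting inequalities
    between [H x1] and [H x2]. *)
Lemma mapH_monotone x1 x2 :
  0 <= dot (mapY G x1 - mapY G x2) (H x1 - H x2).
Proof.
rewrite !mapY_mapH; move: (H x1) (H x2) => a b.
have := sup a b; have := sup b a.
rewrite /supported -[b - a]opprB dotNr dotDl dotNl.
by move: (dot (grad f a) _) (dot (grad f b) _) (f a) (f b) => *; lra.
Qed.

(* If the derivative of H along v vanishes, so do those of f o H and
   (grad f) o H; differentiating x - H x = f (H x) grad G x and
   (1 - |grad G|^2) (grad f) o H = 2 grad G then forces v = 0. *)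
Lemma mapH_det x : \det (jacobian H x) != 0.
Proof.
apply/det0P => -[v /eqP v0 vJ]; apply: v0.
have dH y : differentiable H y by exact: differentiable_mapH.
have DH0 : 'D_v H x = 0 by rewrite deriveEjacobian.
have compH0 k : differentiable k (H x) -> is_derive x v (k \o H) (0 : R).
  move=> dk; have dkH : differentiable (k \o H) x by exact: differentiable_comp.
  split; first exact: diff_derivable.
  by rewrite deriveE // diff_comp //= -[X in 'd k _ X]deriveE // DH0 linear0.
have dp : differentiable p x.
  apply/differentiable_rowP => j.
  rewrite (_ : (fun _ => _) = partial j G); first by case: G_C2 => _ /(_ j)[].
  by apply/funext => y; rewrite mxE.
have Dp := is_derive_diff v dp; set q := 'D_v p x in Dp.
have Dpj j : is_derive x v (partial j G) (q 0 j).
  have -> : partial j G = fun y => p y 0 j by apply/funext => y; rewrite mxE.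
  rewrite /q derive_coord //; split=> //.
  by apply: diff_derivable; move/differentiable_rowP: dp; apply.
have vE : v = F x *: q.
  apply/rowP => j; rewrite mxE.
  have DHj : is_derive x v (fun y => H y 0 j) 0.
    split; last by rewrite -derive_coord // DH0 mxE.
    by apply: diff_derivable; move/differentiable_rowP: (dH x); apply.
  have Dvj : is_derive x v (fun y : 'rV[R]_n => y 0 j) (v 0 j).
    split; first exact/diff_derivable/differentiable_coord.
    by rewrite -(@derive_coord _ _ _ id) // derive_id.
  have E : (fun y : 'rV[R]_n => y 0 j) - (fun y => H y 0 j) =
      (f \o H) * partial j G.
    by apply/funext => y; rewrite /= !fctE /= f_mapH sub_mapH_coord.
  have := is_deriveB Dvj DHj; rewrite E => -[_].
  case: (is_deriveM (compH0 _ (df _)) (Dpj j)) => _ ->.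
  by rewrite /GRing.scale /= mulr0 addr0 subr0 f_mapH.
have qE : q = - dot (p x) q *: grad f (H x).
  apply/rowP => j; rewrite !mxE.
  have dfj : differentiable (partial j f) (H x) by case: f_C2 => _ /(_ j)[].
  have E : (cst 1 - (fun y => dot (p y) (p y))) * (partial j f \o H) =
      cst 2 * partial j G.
    apply/funext => y; have := congr1 (fun w : 'rV_n => w 0 j) (grad_mapH y).
    rewrite [LHS]mxE [X in _ * X]mxE [RHS]mxE [X in _ = _ * X]mxE; exact.
  have := is_deriveM (is_deriveB (is_derive_cst (1 : R) x v) (is_derive_dot Dp Dp))
    (compH0 _ dfj).
  rewrite E => -[_].
  case: (is_deriveM (is_derive_cst (2 : R) x v) (Dpj j)) => _ ->.
  rewrite /GRing.scale /= (dotC q); lra.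
(* Pairing [qE] with [p x] gives <p, q> (1 + <p, grad f (H x)>) = 0; this sign makes the second
   factor positive. *)
have pf : 0 <= dot (p x) (grad f (H x)).
  have := congr1 (dot (p x)) (grad_mapH x); rewrite !dotZr.
  have := grad_lt1 x; have := dot_ge0 (p x); nra.
have pq : dot (p x) q = 0.
  have := congr1 (dot (p x)) qE; rewrite dotZr; nra.
by rewrite vE qE pq oppr0 scale0r scaler0.
Qed.

End Necessity.

(** * Sufficiency: constructing [f] from [G] *)

Section Sufficiency.
Context {R : realType} {n : nat}.
Variables (G : 'rV[R]_n -> R) (g : 'rV[R]_n -> 'rV[R]_n).
Hypotheses (G_pos : positive_valued G) (G_C2 : C2 G).
Notation p := (grad G).
Notation F := (mapF G).
Notation H := (mapH G).
Hypotheses (HK : cancel H g) (gK : cancel g H).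
Hypothesis detH : forall x, \det (jacobian H x) != 0.
Hypothesis p1 : forall x, dot (p x) (p x) < 1.
Hypothesis monoY :
  forall x1 x2, 0 <= dot (mapY G x1 - mapY G x2) (H x1 - H x2).

Let f := F \o g.

Let dG x : differentiable G x. Proof. by case: G_C2 => [[]]. Qed.
Let dH x : differentiable H x. Proof. exact: differentiable_mapH. Qed.

Lemma inv_mapH_C1 j : C1 (fun t => g t 0 j).
Proof. by apply: (inverse_C1 HK gK) => // k; exact: C1_mapH. Qed.

Lemma mapF_inv_C1 : C1 f.
Proof. by apply: C1_comp; [exact: C1_mapF | exact: inv_mapH_C1]. Qed.

Let df t : differentiable f t. Proof. by case: mapF_inv_C1. Qed.

Lemma mapF_inv_pos : positive_valued f.
Proof. by move=> t; exact: mapF_gt0. Qed.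

Lemma mapF_inv_mapH x : f (H x) = F x.
Proof. by rewrite /f /= HK. Qed.

Lemma mapF_subG x :
  F x - G x = F x * (1 - dot (p x) (p x)) / 2.
Proof. have := mapFE G x; lra. Qed.

(* Differentiate the identity mapF_sphere. *)
Lemma derive_mapF x v : 'D_v F x = dot (mapY G x) ('D_v H x).
Proof.
have dF : differentiable F x by case: (C1_mapF G_C2).
have DF := is_derive_grad v dF; rewrite -derive_grad // in DF.
have DG := is_derive_grad v (dG x); have DH := is_derive_diff v (dH x).
have Dx := is_deriveB (is_derive_id x v) DH.
have E : cst 2 * G * F = (fun y => dot ((id - H) y) ((id - H) y)) + F * F.
  by apply/funext => y; exact: mapF_sphere.
have [_] := is_deriveM (is_deriveM (is_derive_cst (2 : R) x v) DG) DF.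
rewrite E; case: (is_deriveD (is_derive_dot Dx Dx) (is_deriveM DF DF)) => _ ->.
rewrite /GRing.scale /= !fctE sub_mapH mapYE !dotE (dotC v) (dotC ('D_v H x)).
set a := 'D_v F x; set pv := dot (p x) v; set ph := dot (p x) ('D_v H x).
have := mapF_subG x; set pp := dot (p x) (p x) => FG E1.
have F0 := mapF_gt0 G_pos x.
have pp1 : 0 < 1 - pp by rewrite subr_gt0 p1.
(* Because [x - H x] is F p, the terms in [pv] cancel in [E1] and leave (F - G) a = F ph. *)
have : F x * (1 - pp) * a = F x * (2 * ph) by nra.
rewrite -mulrA => /(mulfI (lt0r_neq0 F0)) aE.
by apply: (mulfI (lt0r_neq0 pp1)); rewrite aE; field; rewrite gt_eqF.
Qed.

(** Invertibility of the Jacobian makes every [w] a derivative of [H] at [x]; the chain rule for F =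
    f o H then compares with [derive_mapF]. *)
Lemma grad_mapF_inv x : grad f (H x) = mapY G x.
Proof.
apply: dot_inj => w; set v := w *m invmx (jacobian H x).
have -> : w = 'D_v H x.
  by rewrite deriveEjacobian // mulmxKV // unitmxE unitfE.
rewrite -derive_mapF -(derive_grad ('D_v H x) (df (H x))).
have -> : F = f \o H by apply/funext => y; rewrite /= mapF_inv_mapH.
rewrite [in RHS]deriveE; last exact: differentiable_comp.
by rewrite diff_comp //= -!deriveE.
Qed.

(** The definition of [f] involves first derivatives of [G] and so gives only C1. The second order
    is gained from grad f = Y o g, where Y also needs only first derivatives of [G]. *)
Lemma mapF_inv_C2 : C2 f.
Proof.
split=> [|i]; first exact: mapF_inv_C1.
have -> : partial i f = fun t => mapY G (g t) 0 i.
  by apply/funext => t; rewrite -grad_mapF_inv gK mxE.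
apply: (@C1_comp _ _ _ (fun x => mapY G x 0 i) g); first exact: C1_mapY.
exact: inv_mapH_C1.
Qed.

Lemma mapF_inv_supported a b : supported f a b.
Proof.
apply: monotone_supported => // {}a {}b.
by rewrite -(gK a) -(gK b) !grad_mapF_inv.
Qed.

(** By [mapF_subG] the centre is not above the graph point, and (F - G) Y = F p = [x - H x] puts it
    on the normal, so convexity of [f] excludes other points of the graph from the open ball. *)
Lemma mapF_inv_touches x : touches f x (G x) (H x).
Proof.
have F0 := mapF_gt0 G_pos x; have FG := mapF_subG x.
have pp1 : 0 < 1 - dot (p x) (p x) by rewrite subr_gt0 p1.
apply: supported_touches; rewrite ?mapF_inv_mapH.
- by move=> s; exact: mapF_inv_supported.
- have := mulr_ge0 (ltW F0) (ltW pp1); lra.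
- rewrite sub_mapH FG grad_mapF_inv mapYE scalerA; congr (_ *: _).
  by field; rewrite gt_eqF.
- exact: mapF_sphere.
Qed.

End Sufficiency.

(** * The equivalence, with equidistance expressed by [touches] in both directions *)

Unset Implicit Arguments.

Theorem theorem6 (R : realType) (n : nat) (G : 'rV[R]_n -> R)
    (G_C2 : C2 G) (G_convex : convex_function [set: 'rV[R]_n] G)
    (G_pos : positive_valued G) :
  (exists f : 'rV[R]_n -> R,
      [/\ positive_valued f, C2 f, convex_function [set: 'rV[R]_n] f &
          equidistant_function f G])
  <->
  [/\ bijective (mapH G),
      forall x : 'rV[R]_n, \det (jacobian (mapH G) x) != 0,
      forall x : 'rV[R]_n, enorm (grad G x) < 1 &
      forall x1 x2 : 'rV[R]_n,
        0 <= dot (mapY G x1 - mapY G x2) (mapH G x1 - mapH G x2)].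
Proof.
split=> [[f [f_pos f_C2 f_convex eqfG]]|[[g HK gK] detH p1 monoY]].
  have cf : continuous f by case: f_C2 => + _; exact: C1_continuous.
  move: eqfG => /(equidistant_functionP cf f_pos G_pos) touchG.
  split.
  - exact: (mapH_bij f_pos f_C2).
  - exact: (mapH_det f_pos f_C2).
  - by move=> x; rewrite enorm_lt1; exact: (grad_lt1 f_pos f_C2).
  - exact: (mapH_monotone f_pos f_C2).
have {}p1 x : dot (grad G x) (grad G x) < 1 by rewrite -enorm_lt1.
have fC2 : C2 (mapF G \o g) by exact: mapF_inv_C2.
have fpos : positive_valued (mapF G \o g) by exact: mapF_inv_pos.
exists (mapF G \o g); split=> //.
- by apply: supported_convex; exact: mapF_inv_supported.
- apply/equidistant_functionP => //.
    by case: fC2 => + _; exact: C1_continuous.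
  by move=> x; exists (mapH G x); exact: mapF_inv_touches.
Qed.
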